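(* Let $\beta\in\mathbb{R}\setminus\{0\}$ and let the finite-horizon MDP, the deterministic policy $\mu_\theta$, the soft value functions $V_t,Q_t$, the objective $J^\beta(\mu_\theta)$ and the twisted state densities $\rho^*_t$ be as in the context, under the regularity assumptions (D1)–(D3). Then $$\nabla_\theta J^\beta(\mu_\theta)=\sum_{t=1}^T\int_{\mathcal S}\rho^*_t(s)\,\nabla_\theta\mu_\theta(s)\,\nabla_a Q_t(s,a)\big|_{a=\mu_\theta(s)}\,\mathrm{d}s,$$ where $\nabla_\theta\mu_\theta(s)\in\mathbb{R}^{n\times m}$ is the (transposed) Jacobian of $\theta\mapsto\mu_\theta(s)$. (With $\rho^*_\mu:=\sum_t\rho^*_t$, this is the formula $\int_{\mathcal S}\rho^*_\mu(s)\nabla_\theta\mu_\theta(s)\nabla_aQ(s,a)|_{a=\mu_\theta(s)}ds$ with $Q$ taken at the corresponding time step.)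
   Context: Finite-horizon MDP with horizon $T$: state space $\mathcal S\subset\mathbb{R}^d$ compact, action space $\mathcal A=\mathbb{R}^m$, initial density $p_1(s)$, transition density $p(s'|s,a)$, reward $r(s,a)$. Deterministic policy $\mu_\theta:\mathcal S\to\mathbb{R}^m$, $\theta\in\mathbb{R}^n$. Trajectories: $s_1\sim p_1$, $a_t=\mu_\theta(s_t)$, $s_{t+1}\sim p(\cdot|s_t,a_t)$, $r_t=r(s_t,a_t)$. Objective: $J^\beta(\mu_\theta)=\frac1\beta\log\mathbb{E}[e^{\beta\sum_{t=1}^T r_t}]$. Soft value functions: $V_{T+1}\equiv0$; for $t=T,\dots,1$: $Q_t(s,a)=r(s,a)+\frac1\beta\log\int_{\mathcal S}p(s'|s,a)e^{\beta V_{t+1}(s')}ds'$ (defined for all $a\in\mathbb{R}^m$) and $V_t(s)=Q_t(s,\mu_\theta(s))$; thus $J^\beta(\mu_\theta)=\frac1\beta\log\int p_1(s)e^{\beta V_1(s)}ds$. Twisted quantities: $p_1^*(s)\propto p_1(s)e^{\beta V_1(s)}$; $p^*_t(s'|s,a)\propto p(s'|s,a)e^{\beta V_{t+1}(s')}$. $\rho^*_t$ is the marginal density of $s_t$ for the process $s_1\sim p_1^*$, $a_k=\mu_\theta(s_k)$, $s_{k+1}\sim p^*_k(\cdot|s_k,a_k)$. Regularity assumptions: (D1) $p(s'|s,a)$, $\nabla_ap(s'|s,a)$, $\mu_\theta(s)$, $\nabla_\theta\mu_\theta(s)$, $r(s,a)$, $\nabla_ar(s,a)$, $p_1(s)$ are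 continuous in $s,a,s',\theta$; (D2) there are $b,L$ with $\sup_sp_1(s)<b$, $\sup_{s,a,s'}p(s'|s,a)<b$, $\sup_{s,a}|r(s,a)|<b$, $\sup_{s,a,s'}\|\nabla_ap(s'|s,a)\|<L$, $\sup_{s,a}\|\nabla_ar(s,a)\|<L$; (D3) $\mathcal A=\mathbb{R}^m$ and $\mathcal S$ is compact. *)

(* Defs.v *)
From HB Require Import structures.
From mathcomp Require Import all_boot all_order all_algebra.
From mathcomp Require Import all_classical all_reals all_analysis.

Set Implicit Arguments.
Unset Strict Implicit.
Unset Printing Implicit Defensive.
Import Order.TTheory GRing.Theory Num.Theory.
Import numFieldNormedType.Exports.
Local Open Scope classical_set_scope.
Local Open Scope ring_scope.

Section Defs.
Variable R : realType.

Definition evec (n : nat) (i : 'I_n) : 'rV[R]_n := delta_mx 0 i.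

(* Lebesgue integral over R^d of an extended-real function, computed as the
   iterated one-dimensional Lebesgue integral (Fubini/Tonelli); R^0 is a point. *)
Fixpoint iint (d : nat) : ('rV[R]_d -> \bar R) -> \bar R :=
  match d return ('rV[R]_d -> \bar R) -> \bar R with
  | 0 => fun f => f 0
  | d'.+1 => fun f =>
      (\int[@lebesgue_measure R]_x
         iint (fun y : 'rV[R]_d' => f (row_mx (@const_mx R 1 1 x) y)))%E
  end.

Definition intS_leb (d : nat) (S : set 'rV[R]_d) (g : 'rV[R]_d -> R) : R :=
  fine (iint (fun s => (\1_S s * g s)%:E)).

Variables (d m : nat) (S : set 'rV[R]_d) (beta : R) (T : nat).
Variables (p1 : 'rV[R]_d -> R)
          (p : 'rV[R]_d -> 'rV[R]_m -> 'rV[R]_d -> R) (* p s a s' = p(s'|s,a) *)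
          (r : 'rV[R]_d -> 'rV[R]_m -> R)
          (mu : 'rV[R]_d -> 'rV[R]_m).

(* Backward recursion, indexed by k = T+1-t:
   Vb 0 = V_{T+1} = 0 ; Qb (k+1) = Q_{T-k} ; Vb (k+1) = V_{T-k}. *)
Fixpoint Vb (k : nat) : 'rV[R]_d -> R :=
  match k with
  | 0 => fun _ => 0
  | k'.+1 => fun s =>
      r s (mu s) + beta^-1 * ln (intS_leb S (fun s' => p s (mu s) s' * expR (beta * Vb k' s')))
  end.

Definition Vsoft (t : nat) : 'rV[R]_d -> R := Vb (T.+1 - t).

Definition Qsoft (t : nat) (s : 'rV[R]_d) (a : 'rV[R]_m) : R :=
  r s a + beta^-1 * ln (intS_leb S (fun s' => p s a s' * expR (beta * Vsoft t.+1 s'))).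

Definition Jbeta : R :=
  beta^-1 * ln (intS_leb S (fun s => p1 s * expR (beta * Vsoft 1 s))).

Definition p1star (s : 'rV[R]_d) : R :=
  p1 s * expR (beta * Vsoft 1 s) / intS_leb S (fun s0 => p1 s0 * expR (beta * Vsoft 1 s0)).

Definition pstar (t : nat) (s : 'rV[R]_d) (a : 'rV[R]_m) (s' : 'rV[R]_d) : R :=
  p s a s' * expR (beta * Vsoft t.+1 s')
  / intS_leb S (fun s'' => p s a s'' * expR (beta * Vsoft t.+1 s'')).

(* rho_t^* : marginal density of s_t for the twisted process
   s_1 ~ p_1^*, a_k = mu(s_k), s_{k+1} ~ p_k^*(.|s_k,a_k):
   rho_1^* = p_1^*, rho_{t+1}^*(s') = \int_S rho_t^*(s) p_t^*(s'|s,mu(s)) ds. *)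
Fixpoint rhob (k : nat) : 'rV[R]_d -> R :=
  match k with
  | 0 => p1star
  | k'.+1 => fun s' => intS_leb S (fun s => rhob k' s * pstar k'.+1 s (mu s) s')
  end.

Definition rhostar (t : nat) : 'rV[R]_d -> R := rhob t.-1.

End Defs.

Definition gradc (R : realType) (k : nat) (f : 'rV[R]_k -> R) (x : 'rV[R]_k)
  : 'cV[R]_k := \col_i derive f x (evec R i).

Definition jacT (R : realType) (n m : nat) (f : 'rV[R]_n -> 'rV[R]_m) (x : 'rV[R]_n)
  : 'M[R]_(n, m) := \matrix_(i, j) (derive f x (evec R i)) 0 j.

(* Main.v *)
(* Fix a coordinate [i] and move the parameter along [x |-> th + x e_i]. The soft
   Bellman recursion [V_t = r + beta^-1 log (int p e^(beta V_(t+1)))] can be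
   differentiated under the integral: all data are C^1 and [S] is compact, so the
   derivatives of the integrands converge uniformly on [S]. This gives
     V_t' = G_t + int p*_t(s'|s) V_(t+1)'(s') ds',
     G_t(s) = (d mu / d theta_i) . grad_a Q_t,
   and [J' = int p1* V_1']. Integrating the recursion against [rho*_t] and
   exchanging the integrals yields
     int rho*_t V_t' = int rho*_t G_t + int rho*_(t+1) V_(t+1)',
   which telescopes since [V_(T+1) = 0].
   To integrate over [S], the iterated integral [iint] is realised as the integral
   against an honest sigma-finite product measure, pulled back along coordinates. *)
Require Import Defs.
From HB Require Import structures.
From mathcomp Require Import all_boot all_order all_algebra.
From mathcomp Require Import all_classical all_reals all_analysis.
Import Order.TTheory GRing.Theory Num.Theory.
Import numFieldNormedType.Exports.
Local Open Scope classical_set_scope.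
Local Open Scope ring_scope.

Set Implicit Arguments.
Unset Strict Implicit.

(** * Iterated integrals as measure-theoretic integrals *)

(** The data are controlled only for states in [S], so continuity is always relative to a set, and
    it is carried jointly in the parameter and the states. For such an integrand, compactness of [S]
    yields everything at once: boundedness, measurability of the extension by zero, integrability,
    and uniformity in the integration variable near a given parameter. The last point takes the
    place of a dominating function, although actions range over all of R^m. Only partial derivatives
    in the action are given, so composing with the policy requires a chain rule built from
    continuous partials. Logarithms and quotients make sense because a probability density
    integrated against a positive continuous weight on a compact set gives a positive number. *)

Lemma coord_le_norm (R : realType) (n : nat) (v : 'rV[R]_n) (i : 'I_n) :
  `|v 0 i| <= `|v|.
Proof.
rewrite [leRHS]/Num.norm /= mx_normrE; apply/bigmax_geP; right => /=.
by exists (0, i).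
Qed.

(** * Measurability of vector-valued maps through their coordinates *)

Section MeasurableCoordinates.
Variables (disp : measure_display) (X : measurableType disp) (R : realType).
Variables (n : nat) (phi : X -> 'rV[R]_n).
Hypothesis mphi : forall i, measurable_fun setT (fun x => phi x 0 i).

Lemma measurable_preimage_box (v : 'rV[R]_n) (e : R) :
  measurable [set x | forall i, `|phi x 0 i - v 0 i| < e].
Proof.
rewrite [X in measurable X](_ : _ =
  \bigcap_(i in [set: 'I_n])
    ((fun x => phi x 0 i) @^-1` `]v 0 i - e, v 0 i + e[)); last first.
  apply/seteqP; split=> x /= H i.
    by move=> _; rewrite /= in_itv/= -ltr_distl.
  by have := H i I; rewrite /= in_itv/= -ltr_distl.
apply: fin_bigcap_measurable; first exact: finite_finset.
by move=> i _; rewrite -[X in measurable X]setTI; apply: mphi.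
Qed.

(** An open set is the union of the cubes with rational centre and radius [k.+1%:R^-1] that it
    contains. This family is countable, and the preimage of each cube is a finite intersection of
    coordinate conditions. *)
Lemma open_preimage_measurable (U : set 'rV[R]_n) :
  open U -> measurable (phi @^-1` U).
Proof.
move=> oU.
pose B (q : 'rV[rat]_n * nat) :=
  [set v : 'rV[R]_n | forall i, `|v 0 i - ratr (q.1 0 i)| < q.2.+1%:R^-1].
rewrite [X in measurable X](_ : _ = \bigcup_q
   (if `[< B q `<=` U >] then phi @^-1` B q else set0)); last first.
  apply/seteqP; split=> x /=; last first.
    by case=> q _; case: ifPn => // /asboolP BU /BU.
  move=> Ux; have [e e0 eU] : exists2 e : R, 0 < e & ball (phi x) e `<=` U.
    by have /nbhs_ballP[e ? ?] := open_nbhs_nbhs (conj oU Ux); exists e.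
  (* Half of [e], because a point of the cube is within one radius of the rational centre, which is
     itself within one radius of [phi x]. *)
  have [k ke] : exists k, k.+1%:R^-1 < e / 2.
    have e20 : 0 < e / 2 by rewrite divr_gt0.
    have [k _ /(_ _ (leqnn k))] := near_infty_natSinv_lt (PosNum e20).
    by move=> H; exists k.
  have k0 : (0 : R) < k.+1%:R^-1 by rewrite invr_gt0.
  have /choice[q qx] : forall i, exists q : rat, `|phi x 0 i - ratr q| < k.+1%:R^-1.
    move=> i; have /rat_in_itvoo[q] : phi x 0 i - k.+1%:R^-1 < phi x 0 i + k.+1%:R^-1.
      by rewrite ltrD2l gtrN.
    by rewrite in_itv/= -ltr_distl distrC; exists q.
  exists (\row_i q i, k) => //; case: asboolP => [_|].
    by move=> i /=; rewrite mxE.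
  case=> v Bv; apply: eU; split=> // i j; rewrite [i]ord1 /=.
  rewrite /ball /= (splitr e) (le_lt_trans (ler_distD (ratr (q j)) _ _))//.
  rewrite ltrD// (lt_trans _ ke)// distrC.
  by have := Bv j; rewrite /= mxE distrC.
apply: countable_bigcupT_measurable; first exact: countableP.
move=> q; case: ifP => // _.
pose w : 'rV[R]_n := \row_i ratr (q.1 0 i).
have := measurable_preimage_box w q.2.+1%:R^-1; congr measurable.
by apply/seteqP; split=> x /= H i; have := H i; rewrite /= mxE.
Qed.

Lemma closed_preimage_measurable (K : set 'rV[R]_n) :
  closed K -> measurable (phi @^-1` K).
Proof.
move=> cK; rewrite -[K]setCK preimage_setC; apply: measurableC.
exact: open_preimage_measurable (closed_openC cK).
Qed.

(** On [K] the preimage of an open interval is the trace of some open [V], so its pullback is that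
    of [V] intersected with the closed set [K]; off [K] the function is constantly 0. *)
Lemma measurable_indic_within_continuous (K : set 'rV[R]_n) (f : 'rV[R]_n -> R) :
  closed K -> {within K, continuous f} ->
  measurable_fun setT (fun x => \1_K (phi x) * f (phi x)).
Proof.
move=> cK /continuousP cf; have mK := closed_preimage_measurable cK.
rewrite [X in measurable_fun _ X](_ : _ = (f \o phi) \_ (phi @^-1` K)); last first.
  apply/funext => x; rewrite patchE indicE.
  have [xK|xK] := boolP (x \in phi @^-1` K).
    by rewrite (_ : (phi x \in K) = true) ?mul1r//; move: xK; rewrite !inE.
  rewrite (_ : (phi x \in K) = false) ?mul0r//.
  by apply/negbTE; move: xK; apply: contra; rewrite !inE.
have [+ _] := measurable_restrictT (f \o phi) mK; apply.
apply: (measurability _ (measurable_realfun.RGenOpens.measurableE R)) => //.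
move=> _ [_ [a [b ->] <-]].
have [V oV VE] := (open_subspaceP _ _).1 (cf _ (@interval_open R (BRight a) (BLeft b) isT isT)).
have -> : phi @^-1` K `&` (f \o phi) @^-1` `]a, b[ = phi @^-1` (V `&` K).
  by rewrite VE setIC.
by rewrite preimage_setI; apply: measurableI => //; exact: open_preimage_measurable.
Qed.

End MeasurableCoordinates.

Section IteratedIntegral.
Variable R : realType.

(** One constant bounds both the values and the support, so the property passes unchanged to the
    slices met in the induction on the dimension. *)
Definition boxed (n : nat) (M : R) (f : 'rV[R]_n -> R) :=
  (forall v, `|f v| <= M) /\ (forall v, f v != 0 -> forall i, `|v 0 i| <= M).

(* [phi] presents ['rV_d] as a sigma-finite measure space on which [iint] is the
   Lebesgue integral; bounded functions vanishing off a cube keep every partial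
   integral finite, so no [fine] or almost-everywhere junk value can appear. *)
Definition iint_model d disp (X : measurableType disp)
    (nu : {sigma_finite_measure set X -> \bar R}) (phi : X -> 'rV[R]_d) :=
  [/\ forall i, measurable_fun setT (fun x => phi x 0 i),
      forall M : R, (nu [set x | forall i, `|phi x 0 i| <= M]%R < +oo)%E &
      forall (f : 'rV[R]_d -> R) M, measurable_fun setT (f \o phi) -> boxed M f ->
        iint (EFin \o f) = (\int[nu]_x (f (phi x))%:E)%E].

Section Boxed.
Variables (n : nat) (disp : measure_display) (X : measurableType disp).
Variables (nu : {measure set X -> \bar R}) (phi : X -> 'rV[R]_n).
Hypothesis mphi : forall i, measurable_fun setT (fun x => phi x 0 i).

Lemma measurable_cube M : measurable [set x | forall i, `|phi x 0 i| <= M].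
Proof.
rewrite [X in measurable X](_ : _ =
  \bigcap_(i in [set: 'I_n]) ((fun x => phi x 0 i) @^-1` `[- M, M])); last first.
  apply/seteqP; split=> x /= H i.
    by move=> _; rewrite /= in_itv/= -ler_norml.
  by have := H i I; rewrite /= in_itv/= -ler_norml.
apply: fin_bigcap_measurable; first exact: finite_finset.
by move=> i _; rewrite -[X in measurable X]setTI; apply: mphi.
Qed.

Lemma boxed_integrable M (f : 'rV[R]_n -> R) :
  (nu [set x | forall i, `|phi x 0 i| <= M]%R < +oo)%E ->
  measurable_fun setT (f \o phi) -> boxed M f ->
  nu.-integrable setT (fun x => (f (phi x))%:E).
Proof.
move=> nuM mf [fM fbox]; set A := [set x | _] in nuM.
have mA : measurable A := measurable_cube M.
have -> : (fun x => (f (phi x))%:E) = (fun x => (f (phi x))%:E) \_ A.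
  apply/funext => x; rewrite patchE; case: ifPn => // xA.
  case: (eqVneq (f (phi x)) 0) => [->//|fx].
  by move: xA; rewrite notin_setE; case; exact: fbox.
apply/(integrable_mkcond _ mA).
apply: (measurable_bounded_integrable mA nuM).
  exact: measurable_funTS.
exists M; split=> [|K MK x _]; first exact: num_real.
exact: le_trans (fM _) (ltW MK).
Qed.

End Boxed.

Lemma iint_model0 : iint_model (@dirac _ unit tt R) (fun=> 0 : 'rV[R]_0).
Proof.
split=> [i|M|f M mf _]; [by case: i|by rewrite (le_lt_trans (probability_le1 _ _)) ?ltry|].
rewrite integral_dirac ?diracT ?mul1e//.
Qed.

(** * Concatenated vectors over a product measure *)

Section RowMx.
Variables (d1 d2 : measure_display) (X1 : measurableType d1) (X2 : measurableType d2).
Variables (nu1 : {sigma_finite_measure set X1 -> \bar R}).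
Variables (nu2 : {sigma_finite_measure set X2 -> \bar R}).
Variables (n1 n2 : nat) (phi1 : X1 -> 'rV[R]_n1) (phi2 : X2 -> 'rV[R]_n2).
Hypothesis mphi1 : forall i, measurable_fun setT (fun x => phi1 x 0 i).
Hypothesis mphi2 : forall i, measurable_fun setT (fun x => phi2 x 0 i).
Let psi (z : X1 * X2) := row_mx (phi1 z.1) (phi2 z.2).

Lemma measurable_row_mx i : measurable_fun setT (fun z => psi z 0 i).
Proof.
case: (splitP i) => j ij.
  have -> : i = lshift n2 j by apply/val_inj.
  rewrite (_ : (fun z => _) = (fun x => phi1 x 0 j) \o fst); last first.
    by apply/funext => z; rewrite /psi row_mxEl.
  by apply: measurableT_comp => //; exact: measurable_fst.
have -> : i = rshift n1 j by apply/val_inj; exact: ij.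
rewrite (_ : (fun z => _) = (fun x => phi2 x 0 j) \o snd); last first.
  by apply/funext => z; rewrite /psi row_mxEr.
by apply: measurableT_comp => //; exact: measurable_snd.
Qed.

Lemma row_mx_cube_lty (M : R) :
  (nu1 [set x | forall i, `|phi1 x 0 i| <= M]%R < +oo)%E ->
  (nu2 [set x | forall i, `|phi2 x 0 i| <= M]%R < +oo)%E ->
  ((nu1 \x nu2) [set z | forall i, `|psi z 0 i| <= M]%R < +oo)%E.
Proof.
move=> fin1 fin2; rewrite [X in (_ X < _)%E](_ : _ =
  [set x | forall i, `|phi1 x 0 i| <= M] `*` [set x | forall i, `|phi2 x 0 i| <= M]); last first.
  apply/seteqP; split=> [z H|z [/= z1 z2] i].
    by split=> i; [have := H (lshift n2 i)|have := H (rshift n1 i)];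
      rewrite /psi ?row_mxEl ?row_mxEr.
  case: (splitP i) => j ij.
    by rewrite (_ : i = lshift n2 j) ?/psi ?row_mxEl//; apply/val_inj.
  by rewrite (_ : i = rshift n1 j) ?/psi ?row_mxEr//; apply/val_inj; exact: ij.
rewrite product_measure1E//; try exact: measurable_cube.
by rewrite lte_mul_pinfty ?ge0_fin_numE ?fin1 ?fin2.
Qed.

End RowMx.

(** [iint] peels off the first coordinate by an outer Lebesgue integral. Putting a Lebesgue line in
    front of the model in dimension [d] therefore gives the right iterated integral, and Fubini
    turns it into an integral against the product measure. *)
Lemma iint_modelS d disp (X : measurableType disp)
    (nu : {sigma_finite_measure set X -> \bar R}) (phi : X -> 'rV[R]_d) :
  iint_model nu phi -> exists disp' (X' : measurableType disp')
  (nu' : {sigma_finite_measure set X' -> \bar R}) (phi' : X' -> 'rV[R]_d.+1),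
  iint_model nu' phi'.
Proof.
move=> [mphi nufin iintE].
pose line (x : measurableTypeR R) : 'rV[R]_1 := const_mx x.
have mline i : measurable_fun setT (fun x => line x 0 i).
  by rewrite (_ : (fun x => _) = id)//; apply/funext => x; rewrite mxE.
have linefin (M : R) : (@lebesgue_measure R [set x | forall i, `|line x 0%R i| <= M]%R < +oo)%E.
  rewrite [X in (_ X < _)%E](_ : _ = `[(- M)%R, M]%classic).
    by rewrite lebesgue_measure_itv/=; case: ifP => //; rewrite -EFinB ltry.
  apply/seteqP; split=> x /= H; first by have := H 0; rewrite mxE in_itv/= ler_norml.
  by move=> i; rewrite mxE ler_norml; move: H; rewrite in_itv.
pose psi (z : measurableTypeR R * X) : 'rV[R]_(1 + d) := row_mx (line z.1) (phi z.2).
have mpsi i : measurable_fun setT (fun z => psi z 0 i) := measurable_row_mx mline mphi i.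
pose pi := (@lebesgue_measure R \x nu)%E.
have pifin (M : R) : (pi [set z | forall i, `|psi z 0%R i| <= M]%R < +oo)%E.
  exact: (row_mx_cube_lty mline mphi (linefin M) (nufin M)).
have sf : sigma_finite setT pi.
  exists (fun k => [set z | forall i, `|psi z 0 i| <= k%:R]); last first.
    by move=> k; split; [exact: measurable_cube|exact: pifin].
  apply/seteqP; split=> // z _; exists (Num.truncn `|psi z|).+1 => // i.
  by rewrite (le_trans (coord_le_norm _ _))// ltW// truncnS_gt.
(* The library's sigma-finite instance for [\x] is shadowed by the one for
   subprobability measures, hence the explicit packing. *)
pose nu' : {sigma_finite_measure set (measurableTypeR R * X)%type -> \bar R} :=
  HB.pack pi (Measure_isSigmaFinite.Build _ _ _ pi sf).
exists _, _, nu', psi; split=> // f M mf fM.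
transitivity (\int[lebesgue_measure]_x \int[nu]_y (f (psi (x, y)))%:E)%E; last first.
  apply: (@integral12_prod_meas1 _ _ _ _ R (@lebesgue_measure R) nu (fun z => (f (psi z))%:E)).
  exact: (boxed_integrable mpsi (pifin M) mf fM).
apply: eq_integral => x _.
change (iint (EFin \o (fun y : 'rV[R]_d => f (row_mx (@const_mx R 1 1 x) y))) =
  \int[nu]_y (f (psi (x, y)))%:E)%E.
apply: (iintE _ M).
  exact: (measurable_fun_pair2 x mf).
case: fM => fM fbox; split=> // v /fbox H i.
by rewrite -(row_mxEr (@const_mx R 1 1 x) v 0 i); exact: H.
Qed.

Lemma iint_model_ex d : exists disp (X : measurableType disp)
  (nu : {sigma_finite_measure set X -> \bar R}) (phi : X -> 'rV[R]_d),
  iint_model nu phi.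
Proof.
elim: d => [|d [disp [X [nu [phi m]]]]].
  by exists _, _, (@dirac _ unit tt R), (fun=> 0); exact: iint_model0.
exact: iint_modelS m.
Qed.

End IteratedIntegral.

(** * Integration over a compact set *)

Section IntegralOverCompact.
Variables (R : realType) (d : nat) (S : set 'rV[R]_d).
Hypothesis cS : compact S.

Lemma within_continuous_comp (T U V : topologicalType) (A : set T) (B : set U)
    (g : T -> U) (f : U -> V) :
  {within A, continuous g} -> (forall x, A x -> B (g x)) ->
  {within B, continuous f} -> {within A, continuous (f \o g)}.
Proof.
move=> /subspace_continuousP cg AB /subspace_continuousP cf.
apply/subspace_continuousP => x Ax W /(cf _ (AB _ Ax)); rewrite !nbhs_simpl/= => fW.
have := cg _ Ax _ fW; rewrite /within/= !nbhs_simpl/= /nbhs/=.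
by apply: filterS => y H Ay; apply: H => //; exact: AB.
Qed.

(** The maximum with 0 covers vectors off [K], where the function is 0 while [M1] and [M2] may be
    negative if [K] is empty. *)
Lemma boxed_indic (n : nat) (K : set 'rV[R]_n) (g : 'rV[R]_n -> R) (M1 M2 : R) :
  (forall v, K v -> forall i, `|v 0 i| <= M1) -> (forall v, K v -> `|g v| <= M2) ->
  boxed (Num.max 0 (Num.max M1 M2)) (fun v => \1_K v * g v).
Proof.
move=> K1 g2; split=> v; rewrite indicE.
  case: (boolP (v \in K)) => [/set_mem /g2 gv|_]; last by rewrite mul0r normr0 le_max lexx.
  by rewrite mul1r (le_trans gv)// !le_max lexx !orbT.
case: (boolP (v \in K)) => [/set_mem /K1 Kv _ i|_]; last by rewrite mul0r eqxx.
by rewrite (le_trans (Kv i))// !le_max lexx !orbT.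
Qed.

Lemma compact_coord_bounded : exists M, forall v, S v -> forall i, `|v 0 i| <= M.
Proof.
have [M [_ MP]] := compact_bounded cS; exists (M + 1) => v Sv i.
by apply: le_trans (coord_le_norm _ _) _; apply: MP => //; rewrite ltrDl.
Qed.

Lemma within_continuous_bounded (T : topologicalType) (K : set T) (g : T -> R) :
  compact K -> {within K, continuous g} -> exists M, forall v, K v -> `|g v| <= M.
Proof.
move=> cK cg; have cgK : compact (g @` K) by exact: continuous_compact.
have [M [_ MP]] := compact_bounded cgK; exists (M + 1) => v Kv.
by apply: MP; [rewrite ltrDl|exists v].
Qed.

Lemma boxed_compact (g : 'rV[R]_d -> R) : {within S, continuous g} ->
  exists M, boxed M (fun v => \1_S v * g v).
Proof.
move=> /(within_continuous_bounded cS)[M2 M2P]; have [M1 M1P] := compact_coord_bounded.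
by eexists; exact: boxed_indic M1P M2P.
Qed.

Lemma closed_compact_rV : closed S.
Proof. by apply: compact_closed => //; exact: norm_hausdorff. Qed.

Section Model.
Variables (disp : measure_display) (X : measurableType disp).
Variables (nu : {sigma_finite_measure set X -> \bar R}) (phi : X -> 'rV[R]_d).
Hypothesis model : iint_model nu phi.

Lemma model_integrable (g : 'rV[R]_d -> R) : {within S, continuous g} ->
  nu.-integrable setT (EFin \o (fun x => \1_S (phi x) * g (phi x))).
Proof.
move=> cg; have [M bM] := boxed_compact cg; have [mphi nufin _] := model.
have mg := measurable_indic_within_continuous mphi closed_compact_rV cg.
exact: (boxed_integrable mphi (nufin M) mg bM).
Qed.

(** Linearity, monotonicity and Fubini for [intS_leb] are all transported from the Lebesgue integral
    through this identity. *)
Lemma model_intS (g : 'rV[R]_d -> R) : {within S, continuous g} ->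
  intS_leb S g = Rintegral nu setT (fun x => \1_S (phi x) * g (phi x)).
Proof.
move=> cg; have [M bM] := boxed_compact cg; have [mphi nufin iintE] := model.
have mg := measurable_indic_within_continuous mphi closed_compact_rV cg.
by rewrite /intS_leb /Rintegral -(iintE (fun v => \1_S v * g v) M mg bM).
Qed.

End Model.

Lemma intS_eq (f g : 'rV[R]_d -> R) : (forall s, S s -> f s = g s) ->
  intS_leb S f = intS_leb S g.
Proof.
move=> fg; rewrite /intS_leb; congr (fine (iint _)); apply/funext => s.
rewrite indicE; case: (boolP (s \in S)) => [/set_mem /fg ->//|_].
by rewrite !mul0r.
Qed.

Lemma intSD (f g : 'rV[R]_d -> R) :
  {within S, continuous f} -> {within S, continuous g} ->
  intS_leb S (fun s => f s + g s) = intS_leb S f + intS_leb S g.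
Proof.
move=> cf cg; have [disp [X [nu [phi m]]]] := iint_model_ex R d.
have cfg : {within S, continuous (fun s => f s + g s)}.
  by move=> x; apply: cvgD; [exact: cf|exact: cg].
rewrite !(model_intS m)// -RintegralD//; try exact: model_integrable.
by apply: eq_Rintegral => x _; rewrite mulrDr.
Qed.

Lemma intSZ (c : R) (f : 'rV[R]_d -> R) : {within S, continuous f} ->
  intS_leb S (fun s => c * f s) = c * intS_leb S f.
Proof.
move=> cf; have [disp [X [nu [phi m]]]] := iint_model_ex R d.
have cg : {within S, continuous (fun s => c * f s)}.
  by move=> x; apply: cvgM; [exact: cvg_cst|exact: cf].
rewrite !(model_intS m)// -RintegralZl//; last exact: model_integrable.
by apply: eq_Rintegral => x _; rewrite mulrCA.
Qed.

Lemma intS_le (f g : 'rV[R]_d -> R) :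
  {within S, continuous f} -> {within S, continuous g} ->
  (forall s, S s -> f s <= g s) -> intS_leb S f <= intS_leb S g.
Proof.
move=> cf cg fg; have [disp [X [nu [phi m]]]] := iint_model_ex R d.
rewrite !(model_intS m)//; apply: le_Rintegral => //; try exact: model_integrable.
move=> x _; rewrite indicE; case: (boolP (phi x \in S)) => [/set_mem /fg|_].
  by rewrite !mul1r.
by rewrite !mul0r.
Qed.

Lemma within_continuous_cst (T : topologicalType) (A : set T) (c : R) :
  {within A, continuous (fun=> c)}.
Proof. by move=> x; exact: cvg_cst. Qed.

Lemma within_continuous_sum (T : topologicalType) (A : set T) (n : nat)
    (f : 'I_n -> T -> R) : (forall i, {within A, continuous (f i)}) ->
  {within A, continuous (fun x => \sum_i f i x)}.
Proof.
move=> cf; apply: (@continuous_big R^o _ _ _ _ _ (subspace A)) => [|i _].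
  exact: add_continuous.
exact: cf.
Qed.

Lemma intS_sum (n : nat) (f : 'I_n -> 'rV[R]_d -> R) :
  (forall i, {within S, continuous (f i)}) ->
  intS_leb S (fun s => \sum_i f i s) = \sum_i intS_leb S (f i).
Proof.
elim: n f => [|n IH] f cf.
  rewrite big_ord0 -[RHS](mul0r (intS_leb S (fun=> 0))) -intSZ; last exact: within_continuous_cst.
  by apply: intS_eq => s _; rewrite big_ord0 mul0r.
rewrite big_ord_recl -IH// -intSD//.
  by apply: intS_eq => s _; rewrite big_ord_recl.
exact: within_continuous_sum.
Qed.

(** The one quantitative estimate on integrals: with it, uniform convergence on [S] gives
    convergence of the integrals. *)
Lemma intSB_norm_le (f g : 'rV[R]_d -> R) (e : R) :
  {within S, continuous f} -> {within S, continuous g} ->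
  (forall s, S s -> `|f s - g s| <= e) ->
  `|intS_leb S f - intS_leb S g| <= e * intS_leb S (fun=> 1).
Proof.
move=> cf cg fge.
have c1 : {within S, continuous (fun=> 1 : R)} by exact: within_continuous_cst.
have ce : {within S, continuous (fun=> e * 1)} by exact: within_continuous_cst.
rewrite -intSZ// ler_distl; apply/andP; split.
  rewrite lerBlDr -intSD//; apply: intS_le => //.
    by move=> x; apply: cvgD; [exact: cf|exact: ce].
  by move=> s /fge; rewrite ler_distl mulr1 lerBlDr => /andP[].
rewrite -intSD//; apply: intS_le => //.
  by move=> x; apply: cvgD; [exact: cg|exact: ce].
by move=> s /fge; rewrite ler_distl mulr1 => /andP[].
Qed.

Lemma intS_ge0 (f : 'rV[R]_d -> R) : {within S, continuous f} ->
  (forall s, S s -> 0 <= f s) -> 0 <= intS_leb S f.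
Proof.
move=> cf f0; rewrite -(mul0r (intS_leb S f)) -intSZ//.
apply: intS_le => // [|s Ss]; last by rewrite mul0r f0.
by move=> s; apply: cvgM; [exact: cvg_cst|exact: cf].
Qed.

Lemma intS_volume_ge0 : 0 <= intS_leb S (fun=> 1).
Proof. by apply: intS_ge0; first exact: within_continuous_cst. Qed.

Lemma within_continuous_slice (Y T U : topologicalType) (A : set Y) (B : set T)
    (F : Y -> T -> U) y : A y ->
  {within A `*` B, continuous (fun z => F z.1 z.2)} -> {within B, continuous (F y)}.
Proof.
move=> Ay cF; apply: (within_continuous_comp (g := pair y) _ _ cF).
  by apply: continuous_subspaceT => x; apply: cvg_pair => //=; exact: cvg_cst.
by move=> x Bx.
Qed.

(** A tube argument. Joint continuity at [(y0, s)] gives a product neighbourhood on which both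
    [F y s'] and [F y0 s'] are within [e / 2] of [F y0 s]; compactness of [S], as a near-covering
    property, leaves one neighbourhood of [y0] valid for all states. *)
Lemma near_uniform_slice (Y : topologicalType) (A : set Y) (F : Y -> 'rV[R]_d -> R) y0 e :
  {within A `*` S, continuous (fun z => F z.1 z.2)} -> A y0 -> 0 < e ->
  \forall y \near within A (nbhs y0), forall s, S s -> `|F y s - F y0 s| < e.
Proof.
move=> cF Ay0 e0.
move/compact_near_coveringP/near_covering_withinP: cS.
apply => s Ss.
have /subspace_continuousP/(_ (y0, s) (conj Ay0 Ss))/cvgrPdist_lt := cF.
have e20 : 0 < e / 2 by rewrite divr_gt0.
move=> /(_ _ e20) [] /= [U V] /= [Uy0 Vs] UV.
exists (V, A `&` U); first by split=> //=; apply: filterI; [exact: withinT|exact: cvg_within].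
case=> s' y /= [Vs' [Ay Uy]] Ss'.
have H1 := UV (y, s') (conj Uy Vs') (conj Ay Ss').
have H2 := UV (y0, s') (conj (nbhs_singleton Uy0) Vs') (conj Ay0 Ss').
rewrite (splitr e) (le_lt_trans (ler_distD (F y0 s) _ _))// ltrD//.
by rewrite distrC.
Qed.

Lemma intS_continuous (Y : topologicalType) (A : set Y) (F : Y -> 'rV[R]_d -> R) :
  {within A `*` S, continuous (fun z => F z.1 z.2)} ->
  {within A, continuous (fun y => intS_leb S (F y))}.
Proof.
move=> cF; apply/subspace_continuousP => y0 Ay0; apply/cvgrPdist_lt => e e0.
pose V := intS_leb S (fun=> 1).
(* Dividing by [V + 1] instead of [V] keeps the tolerance meaningful when [S] has volume zero. *)
have V1 : 0 < V + 1 by rewrite ltr_wpDl// intS_volume_ge0.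
have := near_uniform_slice cF Ay0 (divr_gt0 e0 V1).
have : \forall y \near within A (nbhs y0), A y by exact: withinT.
apply: filterS2 => y Ay H; rewrite distrC.
rewrite (le_lt_trans (@intSB_norm_le _ _ (e / (V + 1)) _ _ _))//.
- exact: within_continuous_slice cF.
- exact: within_continuous_slice cF.
- by move=> s /H /ltW.
- by rewrite mulrAC ltr_pdivrMr// ltr_pM2l// ltrDl.
Qed.

(* Glue the two variables into one row vector so that joint measurability is an
   instance of the one-vector case. *)
Lemma intS_Fubini (F : 'rV[R]_d -> 'rV[R]_d -> R) :
  {within S `*` S, continuous (fun z => F z.1 z.2)} ->
  intS_leb S (fun s => intS_leb S (F s)) =
  intS_leb S (fun s' => intS_leb S (F ^~ s')).
Proof.
move=> cF; have [disp [X [nu [phi m]]]] := iint_model_ex R d.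
have [mphi nufin _] := m.
have cFV : {within S `*` S, continuous (fun z => F z.2 z.1)}.
  apply: (within_continuous_comp (g := fun z => (z.2, z.1)) _ _ cF).
    by apply: continuous_subspaceT => x; exact: swap_continuous.
  by move=> z [].
pose K := [set v : 'rV[R]_(d + d) | S (lsubmx v) /\ S (rsubmx v)].
pose f (v : 'rV[R]_(d + d)) := F (lsubmx v) (rsubmx v).
have cl : continuous (@lsubmx R 1 d d).
  by move=> v; apply: differentiable_continuous; exact: differentiable_lsubmx.
have cr : continuous (@rsubmx R 1 d d).
  by move=> v; apply: differentiable_continuous; exact: differentiable_rsubmx.
have cK : closed K.
  by apply: (@closedI _ (lsubmx @^-1` S) (rsubmx @^-1` S)); 
    apply: (preimage_closed _ closed_compact_rV) => v _; [exact: cl|exact: cr].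
have cf : {within K, continuous f}.
  apply: (within_continuous_comp (g := fun v => (lsubmx v, rsubmx v)) _ _ cF) => //.
  by apply: continuous_subspaceT => v; exact: (cvg_pair (cl v) (cr v)).
pose psi (z : X * X) := row_mx (phi z.1) (phi z.2).
pose h z := \1_K (psi z) * f (psi z).
have hl x y : h (x, y) = \1_S (phi x) * (\1_S (phi y) * F (phi x) (phi y)).
  rewrite mulrA /h /f /psi /= row_mxKl row_mxKr; congr (_ * _).
  rewrite !indicE -natrM mulnb; congr (_%:R); congr nat_of_bool.
  by apply/idP/andP => [/set_mem[]|[/set_mem ? /set_mem ?]]; rewrite ?row_mxKl ?row_mxKr;
    [split; exact: mem_set|apply: mem_set; split; rewrite /= ?row_mxKl ?row_mxKr].
have hint : (nu \x nu)%E.-integrable setT (EFin \o h).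
  have [M bM] : exists M, boxed M (fun v => \1_K v * f v).
    have [M1 M1P] := compact_coord_bounded.
    have [M2 M2P] := within_continuous_bounded (compact_setX cS cS) cF.
    eexists; apply: (@boxed_indic _ _ _ M1 M2) => v [Sl Sr] => [i|]; last exact: (M2P (_, _)).
    rewrite -[v]hsubmxK; case: (splitP i) => j ij.
      by rewrite (_ : i = lshift d j) ?row_mxEl ?M1P//; apply/val_inj.
    by rewrite (_ : i = rshift d j) ?row_mxEr ?M1P//; apply/val_inj; exact: ij.
  have mh := measurable_indic_within_continuous (measurable_row_mx mphi mphi) cK cf.
  exact: (boxed_integrable (measurable_row_mx mphi mphi)
    (row_mx_cube_lty mphi mphi (nufin M) (nufin M)) mh bM).
(* The inner integral is a real number for every [x]: if [phi x] lies in [S] the slice is continuous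
   on [S], and otherwise the indicator kills both sides. *)
have slice (G : 'rV[R]_d -> 'rV[R]_d -> R) (x : X) :
    {within S `*` S, continuous (fun z => G z.1 z.2)} ->
    (\int[nu]_y (\1_S (phi x) * (\1_S (phi y) * G (phi x) (phi y)))%:E =
    (\1_S (phi x) * intS_leb S (G (phi x)))%:E)%E.
  move=> cG; rewrite indicE; case: (boolP (phi x \in S)) => [/set_mem Sx|_].
    have cGx := within_continuous_slice Sx cG.
    rewrite mul1r (model_intS m cGx) /Rintegral fineK.
      by apply: eq_integral => y _; rewrite mul1r.
    exact: integrable_fin_num (model_integrable m cGx).
  by rewrite mul0r integral0_eq// => y _; rewrite mul0r.
rewrite (model_intS m (intS_continuous cF)) (model_intS m (intS_continuous cFV)).
rewrite /Rintegral; congr fine.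
transitivity (\int[nu]_x \int[nu]_y (h (x, y))%:E)%E.
  by apply: eq_integral => x _; rewrite -slice//; apply: eq_integral => y _; rewrite hl.
rewrite (@Fubini _ _ _ _ R nu nu (EFin \o h))//.
apply: eq_integral => y _; rewrite -(slice (fun a b => F b a))//.
by apply: eq_integral => x _; rewrite /= hl mulrCA.
Qed.

End IntegralOverCompact.

(** * One-variable calculus *)

Section Calculus.
Variable R : realType.

(** Restriction to a line makes a directional derivative an ordinary one, to which the mean value
    theorem applies. *)
Lemma is_derive_line (V W : normedModType R) (f : V -> W) (a v : V) (u : R) :
  derivable f (u *: v + a) v ->
  is_derive u 1 (fun h => f (h *: v + a)) ('D_v f (u *: v + a)).
Proof.
move=> fv; have E : (fun h => h^-1 *: (f ((h *: (1 : R) + u) *: v + a) - f (u *: v + a))) =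
    (fun h => h^-1 *: (f (h *: v + (u *: v + a)) - f (u *: v + a))).
  by apply/funext => h; rewrite scalerDl addrA [h *: 1]mulr1.
by split; [rewrite /derivable /= E|rewrite /derive /= E].
Qed.

Lemma is_derive_of_line (V W : normedModType R) (f : V -> W) (a v : V) (df : W) :
  is_derive (0 : R) 1 (fun h => f (h *: v + a)) df -> is_derive a v f df.
Proof.
have E : (fun h => h^-1 *: (f ((h *: (1 : R) + 0) *: v + a) - f (0 *: v + a))) =
    (fun h => h^-1 *: (f (h *: v + a) - f a)).
  by apply/funext => h; rewrite scale0r add0r addr0 [h *: 1]mulr1.
case; rewrite /derivable /derive /= E => d1 d2.
by split.
Qed.

Lemma is_derive_of_cvg (W : normedModType R) (f : R -> W) (x : R) (df : W) :
  h^-1 *: (f (h + x) - f x) @[h --> 0^'] --> df -> is_derive x 1 f df.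
Proof.
have E : (fun h => h^-1 *: (f (h *: 1 + x) - f x)) = (fun h => h^-1 *: (f (h + x) - f x)).
  by apply/funext => h; rewrite [h *: 1]mulr1.
move=> fdf; split; rewrite /derivable /derive /= E; first exact: cvgP fdf.
exact: cvg_lim fdf.
Qed.

Lemma is_derive_cvg (W : normedModType R) (f : R -> W) (x : R) (df : W) :
  is_derive x 1 f df -> h^-1 *: (f (h + x) - f x) @[h --> 0^'] --> df.
Proof.
have E : (fun h => h^-1 *: (f (h *: 1 + x) - f x)) = (fun h => h^-1 *: (f (h + x) - f x)).
  by apply/funext => h; rewrite [h *: 1]mulr1.
by case; rewrite /derivable /derive /= E => cf <-.
Qed.

Lemma is_derive_continuous (W : normedModType R) (f : R -> W) (x : R) (df : W) :
  is_derive x 1 f df -> {for x, continuous f}.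
Proof. by case=> /derivable1_diffP/differentiable_continuous. Qed.

(** The endpoints come in either order, and the intermediate point is located only by its distance
    to [a]; this is what forces it to converge to [a] when [b] does. *)
Lemma MVT_between (g g' : R -> R) (a b : R) :
  (forall x : R, is_derive x 1 g (g' x)) ->
  exists2 c, `|c - a| <= `|b - a| & g b - g a = g' c * (b - a).
Proof.
move=> dg; have cg A : {within A, continuous g}.
  by apply: continuous_subspaceT => x; exact: is_derive_continuous (dg x).
have [ab|/ltW ba] := leP a b.
  have [c + E] := MVT_segment ab (fun x _ => dg x) (cg _).
  rewrite in_itv/= => /andP[ac cb]; exists c => //.
  by rewrite !ger0_norm ?subr_ge0// lerB.
have [c + E] := MVT_segment ba (fun x _ => dg x) (cg _).
rewrite in_itv/= => /andP[bc ca]; exists c.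
  by rewrite !ler0_norm ?subr_le0// lerN2 lerB.
by rewrite -opprB E -mulrN opprB.
Qed.

Lemma norm_le_coord (n : nat) (v : 'rV[R]_n) (M : R) : 0 <= M ->
  (forall i, `|v 0 i| <= M) -> `|v| <= M.
Proof.
move=> M0 vM; rewrite [leLHS]/Num.norm /= mx_normrE; apply/bigmax_leP; split=> //.
by case=> i j _ /=; rewrite [i]ord1.
Qed.

(* Moving from [a] to [b] one coordinate at a time. *)
Lemma increment_partials (m : nat) (f : 'rV[R]_m -> R) (a b : 'rV[R]_m) :
  (forall y j, derivable f y (evec R j)) ->
  exists xi : 'I_m -> 'rV[R]_m, (forall j, `|xi j - a| <= `|b - a|) /\
    f b - f a = \sum_j gradc f (xi j) j 0 * (b 0 j - a 0 j).
Proof.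
move=> df; pose c k : 'rV[R]_m := \row_i if (i < k)%N then b 0 i else a 0 i.
have step (j : 'I_m) : exists y, `|y - a| <= `|b - a| /\
    f (c j.+1) - f (c j) = gradc f y j 0 * (b 0 j - a 0 j).
  have [u uP E] := MVT_between 0 (b 0 j - a 0 j)
    (fun u => is_derive_line (df (u *: evec R j + c j) j)).
  exists (u *: evec R j + c j); split.
    (* The norm is the maximum of the coordinates, so replacing some coordinates of [a] by those of
       [b], and one of them partly, stays within distance [|b - a|] of [a]. *)
    apply: norm_le_coord => // i; rewrite !mxE eqxx /=.
    have [ij|] := eqVneq i j.
      rewrite ij ltnn mulr1 addrK (le_trans _ (coord_le_norm _ j))//.
      by rewrite !mxE; move: uP; rewrite !subr0.
    rewrite mulr0 add0r => _; case: ifP => _; last by rewrite subrr normr0.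
    by rewrite (le_trans _ (coord_le_norm _ i))// !mxE.
  have <- : f ((b 0 j - a 0 j) *: evec R j + c j) = f (c j.+1).
    congr f; apply/rowP => i; rewrite !mxE eqxx /= ltnS -val_eqE /=.
    case: ltngtP => [_|_|ij]; [by rewrite mulr0 add0r..|].
    by rewrite (val_inj ij) mulr1 subrK.
  by move: E; rewrite scale0r add0r subr0 mxE.
have [xi xiP] := choice step.
exists xi; split=> [j|]; first by have [] := xiP j.
rewrite (_ : f b = f (c m)); last first.
  by congr f; apply/rowP => i; rewrite mxE ltn_ord.
rewrite (_ : f a = f (c 0%N)); last by congr f; apply/rowP => i; rewrite mxE.
rewrite -(telescope_sumr (fun k => f (c k)))// big_mkord.
by apply: eq_bigr => j _; have [_] := xiP j.
Qed.

(** The difference quotient is the sum of the quotients of the coordinates of [a], each weighted by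
    a partial derivative of [f] at an intermediate point. These points are squeezed towards [a x],
    where the partials are continuous. *)
Lemma is_derive_chain (m : nat) (f : 'rV[R]_m -> R) (a : R -> 'rV[R]_m) (x : R)
    (da : 'rV[R]_m) :
  (forall y j, derivable f y (evec R j)) -> {for a x, continuous (gradc f)} ->
  is_derive x 1 a da ->
  is_derive x 1 (f \o a) (\sum_j da 0 j * gradc f (a x) j 0).
Proof.
move=> df cf ax; apply: is_derive_of_cvg.
have [xi xiP] := choice (fun h => increment_partials (a x) (a (h + x)) df).
rewrite (_ : (fun h => _) = (fun h => \sum_j (h^-1 *: (a (h + x) - a x)) 0 j *
    gradc f (xi h j) j 0)); last first.
  apply/funext => h /=; have [_ ->] := xiP h; rewrite scaler_sumr.
  by apply: eq_bigr => j _; rewrite !mxE mulrAC -mulrA.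
have cxi j : xi h j @[h --> 0^'] --> a x.
  have shx : h + x @[h --> 0^'] --> x.
    rewrite -[X in _ --> X]add0r; apply: cvgD; [exact: cvg_within|exact: cvg_cst].
  have /cvgrPdist_lt ca := cvg_comp _ _ shx (is_derive_continuous ax).
  apply/cvgrPdist_lt => e /ca; apply: filterS => h.
  by rewrite /= !(distrC (a x)); have [/(_ j) + _] := xiP h; exact: le_lt_trans.
apply: (@cvg_big R^o) => [|j _]; first exact: add_continuous.
apply: cvgM.
  apply: (cvg_comp _ (fun v : 'rV[R]_m => v 0 j) (is_derive_cvg ax)).
  exact: coord_continuous.
apply: (cvg_comp _ (fun v : 'cV[R]_m => v j 0) (cvg_comp _ _ (cxi j) cf)).
exact: coord_continuous.
Qed.

(** For each state the mean value theorem rewrites the difference quotient as [F'] at an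
    intermediate parameter. That parameter depends on the state, but [F'] is uniformly close to
    [F' x] on [S] for all parameters near [x]. *)
Lemma is_derive_intS (d : nat) (S : set 'rV[R]_d) (F F' : R -> 'rV[R]_d -> R) (x : R) :
  compact S ->
  (forall y, {within S, continuous (F y)}) ->
  (forall (y : R) s, S s -> is_derive y 1 (F ^~ s) (F' y s)) ->
  {within [set: R] `*` S, continuous (fun z => F' z.1 z.2)} ->
  is_derive x 1 (fun y => intS_leb S (F y)) (intS_leb S (F' x)).
Proof.
move=> cS cF dF cF'; apply: is_derive_of_cvg; apply/cvgrPdist_lt => e e0.
pose V := intS_leb S (fun=> 1 : R).
have V1 : 0 < V + 1 by rewrite ltr_wpDl// intS_volume_ge0.
have eV : 0 < e / (V + 1) by rewrite divr_gt0.
have : \forall y \near within setT (nbhs x), forall s, S s -> `|F' y s - F' x s| < e / (V + 1).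
  exact: near_uniform_slice.
rewrite /within/= => /nbhs_ballP[del del0 /= ballP].
near=> h.
have h0 : h != 0 by near: h; exact: nbhs_dnbhs_neq.
have hdel : `|h| < del by near: h; exact: dnbhs0_lt.
have -> : h^-1 *: (intS_leb S (F (h + x)) - intS_leb S (F x)) =
    intS_leb S (fun s => h^-1 * (F (h + x) s + - 1 * F x s)).
  have cN : {within S, continuous (fun s => - 1 * F x s)}.
    by move=> s; apply: cvgM; [exact: cvg_cst|exact: cF].
  rewrite intSZ//; last by move=> s; apply: cvgD; [exact: cF|exact: cN].
  by rewrite intSD// intSZ// mulN1r.
rewrite (le_lt_trans (@intSB_norm_le _ _ _ _ _ _ (e / (V + 1)) _ _ _))//.
- exact: within_continuous_slice cF'.
- move=> s; apply: cvgM; first exact: cvg_cst.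
  by apply: cvgD; [exact: cF|apply: cvgM; [exact: cvg_cst|exact: cF]].
- move=> s Ss; have [c + E] := MVT_between x (h + x) (fun y => dF y s Ss).
  rewrite addrK => ch.
  rewrite mulN1r E addrK mulrCA mulVf// mulr1 distrC ltW//.
  by apply: ballP => //; rewrite /ball/= distrC (le_lt_trans ch).
- by rewrite mulrAC ltr_pdivrMr// ltr_pM2l// ltrDl.
Unshelve. all: by end_near.
Qed.

Lemma is_derive_ln_comp (g : R -> R) (x dg : R) :
  0 < g x -> is_derive x 1 g dg -> is_derive x 1 (fun y => ln (g y)) (dg / g x).
Proof.
move=> g0 dgx; rewrite mulrC.
exact: (is_derive1_comp (is_derive1_ln g0) dgx).
Qed.

Lemma is_derive_expR_comp (g : R -> R) (x dg : R) :
  is_derive x 1 g dg -> is_derive x 1 (fun y => expR (g y)) (dg * expR (g x)).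
Proof. by move=> dgx; rewrite mulrC; exact: (is_derive1_comp (is_derive_expR _) dgx). Qed.

End Calculus.

(** * Stability of relative continuity *)

Section WithinContinuity.
Variables (R : realType) (Y : topologicalType) (A : set Y).

Lemma within_continuousD (f g : Y -> R) : {within A, continuous f} ->
  {within A, continuous g} -> {within A, continuous (fun y => f y + g y)}.
Proof. by move=> cf cg y; apply: cvgD; [exact: cf|exact: cg]. Qed.

Lemma within_continuousM (f g : Y -> R) : {within A, continuous f} ->
  {within A, continuous g} -> {within A, continuous (fun y => f y * g y)}.
Proof. by move=> cf cg y; apply: cvgM; [exact: cf|exact: cg]. Qed.

Lemma within_continuous_pair (U V : topologicalType) (f : Y -> U) (g : Y -> V) :
  {within A, continuous f} -> {within A, continuous g} ->
  {within A, continuous (fun y => (f y, g y))}.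
Proof. by move=> cf cg y; exact: (cvg_pair (cf y) (cg y)). Qed.

Lemma within_continuous_post (U V : topologicalType) (g : U -> V) (f : Y -> U) :
  {within A, continuous f} -> (forall y, A y -> {for f y, continuous g}) ->
  {within A, continuous (g \o f)}.
Proof.
move=> /subspace_continuousP cf cg; apply/subspace_continuousP => y Ay.
exact: (cvg_comp _ _ (cf _ Ay) (cg _ Ay)).
Qed.

Lemma within_continuousV (f : Y -> R) : {within A, continuous f} ->
  (forall y, A y -> f y != 0) -> {within A, continuous (fun y => (f y)^-1)}.
Proof.
move=> cf f0; apply: (within_continuous_post (g := fun x : R => x^-1) cf) => y Ay.
exact: inv_continuous (f0 _ Ay).
Qed.

Lemma within_continuous_ln (f : Y -> R) : {within A, continuous f} ->
  (forall y, A y -> 0 < f y) -> {within A, continuous (fun y => ln (f y))}.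
Proof.
move=> cf f0; apply: (within_continuous_post (g := @ln R) cf) => y Ay.
exact: continuous_ln (f0 _ Ay).
Qed.

Lemma within_continuous_expR (f : Y -> R) : {within A, continuous f} ->
  {within A, continuous (fun y => expR (f y))}.
Proof.
move=> cf; apply: (within_continuous_post (g := @expR R) cf) => y Ay.
exact: continuous_expR.
Qed.

Lemma within_continuous_fst (T U : topologicalType) (B : set T) (f : Y -> U) :
  {within A, continuous f} -> {within A `*` B, continuous (fun z => f z.1)}.
Proof.
move=> cf; apply: (within_continuous_comp (g := fst) _ _ cf) => [|z []//].
by apply: continuous_subspaceT => z; exact: cvg_fst.
Qed.

Lemma within_continuous_snd (T U : topologicalType) (B : set T) (f : Y -> U) :
  {within A, continuous f} -> {within B `*` A, continuous (fun z => f z.2)}.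
Proof.
move=> cf; apply: (within_continuous_comp (g := snd) _ _ cf) => [|z []//].
by apply: continuous_subspaceT => z; exact: cvg_snd.
Qed.

Lemma within_continuous_id : {within A, continuous (fun y : Y => y)}.
Proof. by apply: continuous_subspaceT => y; exact: cvg_id. Qed.

End WithinContinuity.

(** [W] attains a positive minimum on the compact set [S], and the integral is at least this minimum
    because [q] has mass 1. The mass also excludes an empty [S]. *)
Lemma intS_pos (R : realType) (d : nat) (S : set 'rV[R]_d) (q W : 'rV[R]_d -> R) :
  compact S -> {within S, continuous q} -> {within S, continuous W} ->
  (forall s, S s -> 0 <= q s) -> (forall s, S s -> 0 < W s) -> intS_leb S q = 1 ->
  0 < intS_leb S (fun s => q s * W s).
Proof.
move=> cS cq cW q0 W0 q1.
have [S0|S0] := eqVneq S set0.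
  have : intS_leb S q = intS_leb S (fun s => 0 * q s).
    by apply: intS_eq => s; rewrite S0.
  by rewrite q1 intSZ// mul0r => /eqP; rewrite oner_eq0.
have [c] := compact_EVT_min (proj1 (set0P _) S0) cS cW.
rewrite inE => Sc cmin; apply: (lt_le_trans (W0 _ Sc)).
rewrite -[leLHS]mulr1 -q1 -intSZ//; apply: intS_le => //.
- by apply: within_continuousM => //; exact: within_continuous_cst.
- exact: within_continuousM.
- by move=> s Ss; rewrite mulrC ler_wpM2l ?q0// cmin// inE.
Qed.

(** * Differentiating the soft Bellman recursion *)

Section PolicyGradient.
Variables (R : realType) (d m : nat) (S : set 'rV[R]_d) (beta : R) (T : nat).
Variables (p1 : 'rV[R]_d -> R) (p : 'rV[R]_d -> 'rV[R]_m -> 'rV[R]_d -> R).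
Variables (r : 'rV[R]_d -> 'rV[R]_m -> R).
Hypothesis beta0 : beta != 0.
Hypothesis cS : compact S.
Hypothesis p1_ge0 : forall s, S s -> 0 <= p1 s.
Hypothesis p1_int : intS_leb S p1 = 1.
Hypothesis p1_cont : {within S, continuous p1}.
Hypothesis p_ge0 : forall s a s', S s -> S s' -> 0 <= p s a s'.
Hypothesis p_int : forall s a, S s -> intS_leb S (p s a) = 1.
Hypothesis p_cont : {within S `*` [set: 'rV[R]_m] `*` S,
  continuous (fun x => p x.1.1 x.1.2 x.2)}.
Hypothesis p_derivable : forall s a s' (j : 'I_m), S s -> S s' ->
  derivable (fun a0 => p s a0 s') a (evec R j).
Hypothesis gradp_cont : {within S `*` [set: 'rV[R]_m] `*` S,
  continuous (fun x => gradc (fun a0 => p x.1.1 a0 x.2) x.1.2)}.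
Hypothesis r_cont : {within S `*` [set: 'rV[R]_m], continuous (fun x => r x.1 x.2)}.
Hypothesis r_derivable : forall s a (j : 'I_m), S s -> derivable (r s) a (evec R j).
Hypothesis gradr_cont : {within S `*` [set: 'rV[R]_m],
  continuous (fun x => gradc (r x.1) x.2)}.

Let dp j s a s' := gradc (fun a0 => p s a0 s') a j 0.
Let dr j s a := gradc (r s) a j 0.

Section TestFunctions.
Variables (Y : topologicalType) (A : set Y).
Variables (fs fs' : Y -> 'rV[R]_d) (fa : Y -> 'rV[R]_m).
Hypothesis fsS : forall y, A y -> S (fs y).
Hypothesis fsS' : forall y, A y -> S (fs' y).
Hypothesis cfs : {within A, continuous fs}.
Hypothesis cfs' : {within A, continuous fs'}.
Hypothesis cfa : {within A, continuous fa}.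

(** The arguments are arbitrary continuous maps, so that single slices, parameter families and pairs
    of states are all instances. *)
Lemma p_within_continuous : {within A, continuous (fun y => p (fs y) (fa y) (fs' y))}.
Proof.
apply: (within_continuous_comp (g := fun y => (fs y, fa y, fs' y)) _ _ p_cont).
  by do 2 apply: within_continuous_pair => //.
by move=> y Ay; do !split; [exact: fsS|exact: fsS'].
Qed.

Lemma dp_within_continuous j :
  {within A, continuous (fun y => dp j (fs y) (fa y) (fs' y))}.
Proof.
apply: (within_continuous_post (g := fun v : 'cV[R]_m => v j 0)
  (f := fun y => gradc (fun a0 => p (fs y) a0 (fs' y)) (fa y))).
  apply: (within_continuous_comp (g := fun y => (fs y, fa y, fs' y)) _ _ gradp_cont).
    by do 2 apply: within_continuous_pair => //.
  by move=> y Ay; do !split; [exact: fsS|exact: fsS'].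
by move=> y _; exact: coord_continuous.
Qed.

Lemma r_within_continuous : {within A, continuous (fun y => r (fs y) (fa y))}.
Proof.
apply: (within_continuous_comp (g := fun y => (fs y, fa y)) _ _ r_cont).
  exact: within_continuous_pair.
by move=> y Ay; split => //; exact: fsS.
Qed.

Lemma dr_within_continuous j : {within A, continuous (fun y => dr j (fs y) (fa y))}.
Proof.
apply: (within_continuous_post (g := fun v : 'cV[R]_m => v j 0)
  (f := fun y => gradc (r (fs y)) (fa y))).
  apply: (within_continuous_comp (g := fun y => (fs y, fa y)) _ _ gradr_cont).
    exact: within_continuous_pair.
  by move=> y Ay; split => //; exact: fsS.
by move=> y _; exact: coord_continuous.
Qed.

End TestFunctions.

Lemma gradp_continuous s s' a : S s -> S s' ->
  {for a, continuous (gradc (fun a0 => p s a0 s'))}.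
Proof.
move=> Ss Ss'; suff : {within [set: 'rV[R]_m], continuous (gradc (fun a0 => p s a0 s'))}.
  by move/(continuous_subspace_setT _).2; exact.
apply: (within_continuous_comp (g := fun a => (s, a, s')) _ _ gradp_cont).
  apply: within_continuous_pair; last by move=> x; exact: cvg_cst.
  by apply: within_continuous_pair; [move=> x; exact: cvg_cst|exact: within_continuous_id].
by [].
Qed.

Lemma gradr_continuous s a : S s -> {for a, continuous (gradc (r s))}.
Proof.
move=> Ss; suff : {within [set: 'rV[R]_m], continuous (gradc (r s))}.
  by move/(continuous_subspace_setT _).2; exact.
apply: (within_continuous_comp (g := fun a => (s, a)) _ _ gradr_cont).
  by apply: within_continuous_pair; [move=> x; exact: cvg_cst|exact: within_continuous_id].
by [].
Qed.

(* [W] stands for the next-step value function [V_{t+1}]. *)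
Definition Zint (W : 'rV[R]_d -> R) (s : 'rV[R]_d) (a : 'rV[R]_m) : R :=
  intS_leb S (fun s' => p s a s' * expR (beta * W s')).

Definition dZint (W : 'rV[R]_d -> R) j (s : 'rV[R]_d) (a : 'rV[R]_m) : R :=
  intS_leb S (fun s' => dp j s a s' * expR (beta * W s')).

(** The partial derivative of [Q] in the [j]-th action coordinate, with the logarithm already
    differentiated. The explicit form makes its continuity in all variables accessible; [gradQ]
    identifies it. *)
Definition dQ (W : 'rV[R]_d -> R) j (s : 'rV[R]_d) (a : 'rV[R]_m) : R :=
  dr j s a + beta^-1 * (dZint W j s a / Zint W s a).

Lemma expW_continuous (Y : topologicalType) (A : set Y) (W : Y -> R) :
  {within A, continuous W} -> {within A, continuous (fun y => expR (beta * W y))}.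
Proof.
move=> cW; apply: within_continuous_expR; apply: within_continuousM => //.
exact: within_continuous_cst.
Qed.

Lemma Zint_gt0 (W : 'rV[R]_d -> R) s a : S s -> {within S, continuous W} -> 0 < Zint W s a.
Proof.
move=> Ss cW; apply: intS_pos => //; last exact: p_int.
- apply: (@p_within_continuous _ S (fun=> s) id (fun=> a)) => //;
    try (by move=> x; exact: cvg_cst).
  exact: within_continuous_id.
- exact: expW_continuous.
- by move=> s' Ss'; exact: p_ge0.
- by move=> s' _; exact: expR_gt0.
Qed.

Section ZContinuity.
Variables (Y : topologicalType) (A : set Y) (W : Y -> 'rV[R]_d -> R).
Variables (fs : Y -> 'rV[R]_d) (fa : Y -> 'rV[R]_m).
Hypothesis fsS : forall y, A y -> S (fs y).
Hypothesis cfs : {within A, continuous fs}.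
Hypothesis cfa : {within A, continuous fa}.
Hypothesis cW : {within A `*` S, continuous (fun z => W z.1 z.2)}.

(** [W] depends on [y] as well, since moving the policy also changes the later values. *)
Lemma Zint_within_continuous : {within A, continuous (fun y => Zint (W y) (fs y) (fa y))}.
Proof.
apply: (intS_continuous cS
  (F := fun y s' => p (fs y) (fa y) s' * expR (beta * W y s'))).
apply: within_continuousM; last exact: expW_continuous.
apply: (@p_within_continuous _ (A `*` S) (fun z => fs z.1) snd (fun z => fa z.1)).
- by move=> y [/fsS].
- by move=> y [].
- exact: within_continuous_fst.
- by apply: (within_continuous_snd (f := id)); exact: within_continuous_id.
- exact: within_continuous_fst.
Qed.

Lemma dZint_within_continuous j :
  {within A, continuous (fun y => dZint (W y) j (fs y) (fa y))}.
Proof.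
apply: (intS_continuous cS
  (F := fun y s' => dp j (fs y) (fa y) s' * expR (beta * W y s'))).
apply: within_continuousM; last exact: expW_continuous.
apply: (@dp_within_continuous _ (A `*` S) (fun z => fs z.1) snd (fun z => fa z.1)).
- by move=> y [/fsS].
- by move=> y [].
- exact: within_continuous_fst.
- by apply: (within_continuous_snd (f := id)); exact: within_continuous_id.
- exact: within_continuous_fst.
Qed.

Lemma dQ_within_continuous j :
  {within A, continuous (fun y => dQ (W y) j (fs y) (fa y))}.
Proof.
apply: within_continuousD; first exact: dr_within_continuous.
apply: within_continuousM; first exact: within_continuous_cst.
apply: within_continuousM; first exact: dZint_within_continuous.
apply: within_continuousV; first exact: Zint_within_continuous.
move=> y Ay; rewrite gt_eqF// Zint_gt0//; first exact: fsS.
exact: (within_continuous_slice Ay cW).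
Qed.

End ZContinuity.

(** * Value functions and twisted densities along a one-parameter family of policies *)

Section Family.
Variables (mu dmu : R -> 'rV[R]_d -> 'rV[R]_m).
Hypothesis mu_cont : {within [set: R] `*` S, continuous (fun z => mu z.1 z.2)}.
Hypothesis dmu_cont : forall j, {within [set: R] `*` S, continuous (fun z => dmu z.1 z.2 0 j)}.
Hypothesis mu_is_derive : forall (x : R) s, S s -> is_derive x 1 (mu ^~ s) (dmu x s).

Let V k (x : R) := Vb S beta p r (mu x) k.

(* As in [Vb], the index [k] counts backwards: [V k] is [V_(T+1-k)], [dV k] its
   derivative along the family, and [twist k], [dQmu k] belong to time [T-k]. *)
Definition dQmu k x s := \sum_j dmu x s 0 j * dQ (V k x) j s (mu x s).

Definition twist k x s s' :=
  p s (mu x s) s' * expR (beta * V k x s') / Zint (V k x) s (mu x s).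

Fixpoint dV k x s : R :=
  if k is k'.+1 then
    dQmu k' x s + intS_leb S (fun s' => twist k' x s s' * dV k' x s')
  else 0.

(** Inside the recursion the value is read at the integration variable, so it must be viewed on
    triples of parameter, current state and next state. *)
Lemma within_continuous_next (f : R -> 'rV[R]_d -> R) :
  {within [set: R] `*` S, continuous (fun z => f z.1 z.2)} ->
  {within ([set: R] `*` S) `*` S, continuous (fun w => f w.1.1 w.2)}.
Proof.
move=> cf; apply: (within_continuous_comp (g := fun w => (w.1.1, w.2)) _ _ cf).
  apply: within_continuous_pair.
    apply/(within_continuous_fst (f := fst))/(within_continuous_fst (f := id)).
    exact: within_continuous_id.
  by apply/(within_continuous_snd (f := id))/within_continuous_id.
by move=> w [[]].
Qed.

Lemma snd_within_continuous : {within [set: R] `*` S, continuous (fun z => z.2)}.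
Proof. by apply/(within_continuous_snd (f := id))/within_continuous_id. Qed.

Lemma snd_in : forall z : R * 'rV[R]_d, ([set: R] `*` S) z -> S z.2.
Proof. by move=> z []. Qed.

Lemma V_within_continuous k : {within [set: R] `*` S, continuous (fun z => V k z.1 z.2)}.
Proof.
elim: k => [|k IH]; first exact: within_continuous_cst.
have cW := within_continuous_next IH.
apply: (within_continuousD (f := fun z => r z.2 (mu z.1 z.2))
  (g := fun z => beta^-1 * ln (Zint (V k z.1) z.2 (mu z.1 z.2)))).
  exact: (r_within_continuous snd_in snd_within_continuous mu_cont).
apply: within_continuousM; first exact: within_continuous_cst.
apply: (within_continuous_ln (f := fun z => Zint (V k z.1) z.2 (mu z.1 z.2))).
  exact: (Zint_within_continuous snd_in snd_within_continuous mu_cont cW).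
move=> z zS; apply: Zint_gt0; first exact: snd_in.
exact: (within_continuous_slice (F := fun z => V k z.1) zS cW).
Qed.

Lemma V_slice k x : {within S, continuous (V k x)}.
Proof.
exact: (within_continuous_slice (F := V k) (y := x) I (V_within_continuous (k := k))).
Qed.

Lemma twist_within_continuous k :
  {within ([set: R] `*` S) `*` S, continuous (fun w => twist k w.1.1 w.1.2 w.2)}.
Proof.
have cW := within_continuous_next (V_within_continuous (k := k)).
apply: within_continuousM; first apply: within_continuousM.
- apply: (@p_within_continuous _ _ (fun w => w.1.2) (fun w => w.2) (fun w => mu w.1.1 w.1.2)).
  + by move=> w [[]].
  + by move=> w [].
  + by apply/(within_continuous_fst (f := snd))/snd_within_continuous.
  + by apply/(within_continuous_snd (f := id))/within_continuous_id.
  + by apply: (within_continuous_fst (f := fun z => mu z.1 z.2)).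
- exact: expW_continuous.
- apply: (within_continuous_fst (f := fun z => (Zint (V k z.1) z.2 (mu z.1 z.2))^-1)).
  apply: within_continuousV.
    exact: (Zint_within_continuous snd_in snd_within_continuous mu_cont cW).
  by move=> z [_ zS]; rewrite gt_eqF// Zint_gt0//; exact: V_slice.
Qed.

Lemma dQmu_within_continuous k :
  {within [set: R] `*` S, continuous (fun z => dQmu k z.1 z.2)}.
Proof.
have cW := within_continuous_next (V_within_continuous (k := k)).
apply: within_continuous_sum => j; apply: within_continuousM; first exact: dmu_cont.
exact: (dQ_within_continuous snd_in snd_within_continuous mu_cont cW).
Qed.

(** Joint continuity is exactly what [is_derive_intS] asks of the differentiated integrand at the
    next level of the recursion. *)
Lemma dV_within_continuous k : {within [set: R] `*` S, continuous (fun z => dV k z.1 z.2)}.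
Proof.
elim: k => [|k IH]; first exact: within_continuous_cst.
apply: (within_continuousD (f := fun z => dQmu k z.1 z.2)
  (g := fun z => intS_leb S (fun s' => twist k z.1 z.2 s' * dV k z.1 s'))).
  exact: dQmu_within_continuous.
apply: (intS_continuous cS (F := fun z s' => twist k z.1 z.2 s' * dV k z.1 s')).
apply: within_continuousM; first exact: twist_within_continuous.
exact: (within_continuous_next IH).
Qed.

Lemma dV_slice k x : {within S, continuous (dV k x)}.
Proof.
exact: (within_continuous_slice (F := dV k) (y := x) I (dV_within_continuous (k := k))).
Qed.

Lemma slice_pair x s : S s -> ([set: R] `*` S) (x, s).
Proof. by []. Qed.

Lemma twist_slice k x s : S s -> {within S, continuous (twist k x s)}.
Proof.
move=> Ss; exact: (within_continuous_slice (F := fun z => twist k z.1 z.2)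
  (slice_pair x Ss) (twist_within_continuous (k := k))).
Qed.

Lemma p_slice s a : S s -> {within S, continuous (p s a)}.
Proof.
move=> Ss; apply: (@p_within_continuous _ S (fun=> s) id (fun=> a)) => //;
  try (by move=> x; exact: cvg_cst).
exact: within_continuous_id.
Qed.

Lemma dp_slice j s a : S s -> {within S, continuous (dp j s a)}.
Proof.
move=> Ss; apply: (@dp_within_continuous _ S (fun=> s) id (fun=> a)) => //;
  try (by move=> x; exact: cvg_cst).
exact: within_continuous_id.
Qed.

(** The parameter enters twice, through the action in the kernel and through the next value in the
    exponent, whence the two terms. The assumption on [V k] covers every parameter because the mean
    value theorem visits parameters other than [x]. *)
Lemma Zint_is_derive k (x : R) s : S s ->
  (forall (y : R) s', S s' -> is_derive y 1 (fun y => V k y s') (dV k y s')) ->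
  is_derive x 1 (fun y => Zint (V k y) s (mu y s))
    (\sum_j dmu x s 0 j * dZint (V k x) j s (mu x s) +
     beta * intS_leb S (fun s' => p s (mu x s) s' * expR (beta * V k x s') * dV k x s')).
Proof.
move=> Ss dVk.
pose e y s' := expR (beta * V k y s').
pose F y s' := p s (mu y s) s' * e y s'.
pose F' y s' := \sum_j (dmu y s 0 j * (dp j s (mu y s) s' * e y s')) +
   beta * (F y s' * dV k y s').
have ce y : {within S, continuous (e y)} by apply: expW_continuous; exact: V_slice.
have cF y : {within S, continuous (F y)}.
  by apply: within_continuousM => //; exact: p_slice.
suff -> : \sum_j dmu x s 0 j * dZint (V k x) j s (mu x s) +
    beta * intS_leb S (fun s' => p s (mu x s) s' * expR (beta * V k x s') * dV k x s') =
    intS_leb S (F' x).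
  apply: (is_derive_intS (F := F)) => //.
    move=> y s' Ss'.
    have dp' := is_derive_chain (fun b j => @p_derivable s b s' j Ss Ss')
      (gradp_continuous (a := mu y s) Ss Ss') (mu_is_derive y Ss).
    have de : is_derive y 1 (e ^~ s') (beta * dV k y s' * e y s').
      apply: (is_derive_expR_comp (g := fun y => beta * V k y s')).
      exact: (is_deriveZ beta (dVk y s' Ss')).
    have dF : is_derive y 1 (F ^~ s') _ := is_deriveM dp' de.
    apply: (is_derive_eq dF).
    rewrite /F' /F addrC scaler_sumr; congr (_ + _).
      by apply: eq_bigr => j _; rewrite /= [LHS]mulrC mulrA.
    by rewrite /= /GRing.scale/= -!mulrA mulrCA [dV k y s' * _]mulrC.
  have cs : {within [set: R] `*` S, continuous (fun z => mu z.1 s)}.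
    apply: (within_continuous_comp (g := fun z => (z.1, s)) _ _ mu_cont) => //.
    apply: within_continuous_pair; last by move=> z; exact: cvg_cst.
    by apply/(within_continuous_fst (f := id))/within_continuous_id.
  have cds j : {within [set: R] `*` S, continuous (fun z => dmu z.1 s 0 j)}.
    apply: (within_continuous_comp (g := fun z => (z.1, s)) _ _ (dmu_cont (j := j))) => //.
    apply: within_continuous_pair; last by move=> z; exact: cvg_cst.
    by apply/(within_continuous_fst (f := id))/within_continuous_id.
  have cst : {within [set: R] `*` S, continuous (fun=> s)} by move=> z; exact: cvg_cst.
  have ce2 : {within [set: R] `*` S, continuous (fun z => e z.1 z.2)}.
    by apply: expW_continuous; exact: V_within_continuous.
  apply: within_continuousD.
    apply: within_continuous_sum => j; apply: within_continuousM => //.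
    apply: within_continuousM => //.
    exact: (dp_within_continuous (fun _ _ => Ss) snd_in cst snd_within_continuous cs).
  apply: within_continuousM; first exact: within_continuous_cst.
  apply: within_continuousM; last exact: dV_within_continuous.
  apply: within_continuousM => //.
  exact: (p_within_continuous (fun _ _ => Ss) snd_in cst snd_within_continuous cs).
have cFd : {within S, continuous (fun s' => F x s' * dV k x s')}.
  by apply: within_continuousM => //; exact: dV_slice.
have cd j : {within S, continuous (fun s' => dp j s (mu x s) s' * e x s')}.
  by apply: within_continuousM => //; exact: dp_slice.
have cdm j : {within S, continuous (fun s' => dmu x s 0 j * (dp j s (mu x s) s' * e x s'))}.
  by apply: within_continuousM => //; exact: within_continuous_cst.
rewrite /F' intSD//; last 2 first.
- exact: within_continuous_sum.
- by apply: within_continuousM => //; exact: within_continuous_cst.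
rewrite intS_sum// intSZ//; congr (_ + _).
by apply: eq_bigr => j _; rewrite intSZ.
Qed.

Lemma V_is_derive k (x : R) s : S s -> is_derive x 1 (fun y => V k y s) (dV k x s).
Proof.
elim: k x s => [|k IH] x s Ss; first exact: is_derive_cst.
have Z0 : 0 < Zint (V k x) s (mu x s) by apply: Zint_gt0 => //; exact: V_slice.
have dr' := is_derive_chain (fun b j => @r_derivable s b j Ss)
  (gradr_continuous (a := mu x s) Ss) (mu_is_derive x Ss).
have dl := is_derive_ln_comp (g := fun y => Zint (V k y) s (mu y s)) Z0 (Zint_is_derive x Ss IH).
have dVS : is_derive x 1 (fun y => V k.+1 y s) _ := is_deriveD dr' (is_deriveZ beta^-1 dl).
apply: (is_derive_eq dVS).
rewrite /= /dQmu /dQ.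
under [in RHS]eq_bigr do rewrite mulrDr.
rewrite big_split /= -addrA; congr (_ + _).
rewrite /GRing.scale/= mulrDl mulrDr; congr (_ + _).
  rewrite mulr_suml mulr_sumr; apply: eq_bigr => j _.
  by rewrite [RHS]mulrCA !mulrA.
(* The [beta] from the exponent cancels [beta^-1] in front of the logarithm, and division by [Zint]
   turns the remaining weight into [twist]. *)
rewrite -!mulrA mulKf// mulrC -intSZ//; last first.
  apply: within_continuousM; last exact: dV_slice.
  by apply: within_continuousM; [exact: p_slice|apply: expW_continuous; exact: V_slice].
by apply: intS_eq => s' _; rewrite /twist mulrA [_^-1 * _]mulrC.
Qed.

(** Here the next value [W] is frozen and only the current action moves, along [line]; hence a
    single term under the integral. *)
Lemma gradQ (W : 'rV[R]_d -> R) s a j : S s -> {within S, continuous W} ->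
  gradc (fun b => r s b + beta^-1 * ln (Zint W s b)) a j 0 = dQ W j s a.
Proof.
move=> Ss cW; rewrite mxE.
pose line h := h *: evec R j + a.
have cline : continuous line.
  by move=> h; apply: cvgD; [apply: cvgZr_tmp; exact: cvg_id|exact: cvg_cst].
have cl : {within [set: R] `*` S, continuous (fun z => line z.1)}.
  exact/(within_continuous_fst (f := line))/continuous_subspaceT.
have dr' := is_derive_line (u := 0) (r_derivable (a := 0 *: evec R j + a) (j := j) Ss).
have dZ : is_derive (0 : R) 1 (fun h => Zint W s (line h)) (dZint W j s (line 0)).
  apply: (is_derive_intS (F := fun h s' => p s (line h) s' * expR (beta * W s'))
    (F' := fun h s' => dp j s (line h) s' * expR (beta * W s'))) => //.
  - by move=> h; apply: within_continuousM; [exact: p_slice|exact: expW_continuous].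
  - move=> h s' Ss'; have dl := is_derive_line (@p_derivable s (line h) s' j Ss Ss').
    have dl' : is_derive h 1 (fun y => p s (line y) s' * expR (beta * W s')) _ :=
      is_deriveM dl (is_derive_cst (expR (beta * W s')) h 1).
    apply: (is_derive_eq dl').
    by rewrite scaler0 add0r /dp mxE /GRing.scale/= mulrC.
  - apply: within_continuousM.
      apply: (dp_within_continuous (fun _ _ => Ss) snd_in _ snd_within_continuous cl).
      by move=> z; exact: cvg_cst.
    apply: (within_continuous_snd (f := fun s' => expR (beta * W s'))).
    exact: expW_continuous.
have Z0 : 0 < Zint W s (line 0) by exact: Zint_gt0.
have dl := is_derive_ln_comp (g := fun h => Zint W s (line h)) Z0 dZ.
have dL : is_derive (0 : R) 1 (fun h => r s (line h) + beta^-1 * ln (Zint W s (line h))) _ :=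
  is_deriveD dr' (is_deriveZ beta^-1 dl).
have [_ ->] := is_derive_of_line (f := fun b => r s b + beta^-1 * ln (Zint W s b)) dL.
by rewrite /line scale0r add0r /dQ /dr mxE.
Qed.

(** This index runs forward: [rho k] is the density at time [k + 1], while [dV (T - k)] is the
    derivative of the value at that same time. *)
Let rho k x := rhob S beta T p1 p r (mu x) k.

Lemma rho_continuous k x : {within S, continuous (rho k x)}.
Proof.
elim: k => [|k IH].
  apply: within_continuousM; last exact: within_continuous_cst.
  by apply: within_continuousM => //; apply: expW_continuous; exact: V_slice.
(* [rhob] at [k.+1] uses [pstar k.+1], hence [Vsoft k.+2], which is [Vb (T.+1 - k.+2)]. *)
apply: (intS_continuous cS
  (F := fun s' s => rho k x s * twist (T.+1 - k.+2) x s s')).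
apply: within_continuousM; first exact: within_continuous_snd.
apply: (within_continuous_comp (g := fun z : 'rV[R]_d * 'rV[R]_d => (x, z.2, z.1)) _ _
  (twist_within_continuous (k := T.+1 - k.+2))); last by move=> z [].
apply: within_continuous_pair; last first.
  by apply/(within_continuous_fst (f := id))/within_continuous_id.
apply: within_continuous_pair; first by move=> z; exact: cvg_cst.
by apply/(within_continuous_snd (f := id))/within_continuous_id.
Qed.

Lemma rho_step k x : (k < T)%N ->
  intS_leb S (fun s => rho k x s * dV (T - k) x s) =
  intS_leb S (fun s => rho k x s * dQmu (T - k.+1) x s) +
  intS_leb S (fun s => rho k.+1 x s * dV (T - k.+1) x s).
Proof.
move=> kT; set l := (T - k.+1)%N.
have -> : (T - k = l.+1)%N by rewrite /l subnSK.
pose F s s' := rho k x s * (twist l x s s' * dV l x s').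
have cF : {within S `*` S, continuous (fun z => F z.1 z.2)}.
  apply: within_continuousM; first exact/(within_continuous_fst (f := rho k x))/rho_continuous.
  apply: within_continuousM; last exact/(within_continuous_snd (f := dV l x))/dV_slice.
  apply: (within_continuous_comp (g := fun z : 'rV[R]_d * 'rV[R]_d => (x, z.1, z.2)) _ _
    (twist_within_continuous (k := l))); last by move=> z [].
  apply: within_continuous_pair; last first.
    by apply/(within_continuous_snd (f := id))/within_continuous_id.
  apply: within_continuous_pair; first by move=> z; exact: cvg_cst.
  by apply/(within_continuous_fst (f := id))/within_continuous_id.
have ctd s : S s -> {within S, continuous (fun s' => twist l x s s' * dV l x s')}.
  by move=> Ss; apply: within_continuousM; [exact: twist_slice|exact: dV_slice].
transitivity (intS_leb S (fun s => rho k x s * dQmu l x s + intS_leb S (F s))).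
  by apply: intS_eq => s Ss; rewrite /= mulrDr /F intSZ//; exact: ctd.
rewrite intSD//; last 2 first.
- apply: within_continuousM; first exact: rho_continuous.
  exact: (within_continuous_slice (F := dQmu l) (y := x) I (dQmu_within_continuous (k := l))).
- exact: (intS_continuous cS cF).
congr (_ + _); rewrite intS_Fubini//; apply: intS_eq => s' Ss'.
(* [subSS] aligns the two clocks: [pstar k.+1] and [twist l] both weight by [Vb (T - k.+1)]. *)
have -> : rho k.+1 x s' = intS_leb S (fun s => rho k x s * twist l x s s').
  by rewrite /rho /= -/(rho k x) /l /twist /pstar /Vsoft subSS.
rewrite mulrC -intSZ//.
  by apply: intS_eq => s _; rewrite /F mulrA mulrC.
apply: within_continuousM; first exact: rho_continuous.
apply: (within_continuous_comp (g := fun s => (x, s, s')) _ _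
  (twist_within_continuous (k := l))); last by [].
apply: within_continuous_pair; last by move=> z; exact: cvg_cst.
by apply: within_continuous_pair; [move=> z; exact: cvg_cst|exact: within_continuous_id].
Qed.

(** The initial density acts as a transition kernel that does not depend on the parameter; its
    normalised twisted form is [p1star], that is [rho 0]. *)
Lemma J_is_derive (x : R) : is_derive x 1 (fun y => Jbeta S beta T p1 p r (mu y))
  (intS_leb S (fun s => rho 0 x s * dV T x s)).
Proof.
pose e y s := expR (beta * V T y s).
have ce y : {within S, continuous (e y)} by apply: expW_continuous; exact: V_slice.
have Z0 : 0 < intS_leb S (fun s => p1 s * e x s).
  by apply: intS_pos => // s _; exact: expR_gt0.
have cF y : {within S, continuous (fun s => p1 s * e y s)} by exact: within_continuousM.
have dZ : is_derive x 1 (fun y => intS_leb S (fun s => p1 s * e y s))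
    (intS_leb S (fun s => beta * (p1 s * e x s * dV T x s))).
  apply: (is_derive_intS (F := fun y s => p1 s * e y s)
    (F' := fun y s => beta * (p1 s * e y s * dV T y s))) => //.
    move=> y s Ss.
    have de : is_derive y 1 (e ^~ s) (beta * dV T y s * e y s).
      apply: (is_derive_expR_comp (g := fun y => beta * V T y s)).
      exact: (is_deriveZ beta (V_is_derive T y Ss)).
    have dF : is_derive y 1 (fun y => p1 s * e y s) _ := is_deriveZ (p1 s) de.
    apply: (is_derive_eq dF).
    by rewrite /GRing.scale/= -!mulrA mulrCA [dV T y s * _]mulrC.
  apply: within_continuousM; first exact: within_continuous_cst.
  apply: within_continuousM; last exact: dV_within_continuous.
  apply: within_continuousM; first exact: (within_continuous_snd (f := p1)).
  by apply: expW_continuous; exact: V_within_continuous.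
have E y : Jbeta S beta T p1 p r (mu y) = beta^-1 * ln (intS_leb S (fun s => p1 s * e y s)).
  by rewrite /Jbeta /Vsoft subn1.
under eq_fun do rewrite E.
have dJ : is_derive x 1 (fun y => beta^-1 * ln (intS_leb S (fun s => p1 s * e y s))) _ :=
  is_deriveZ beta^-1 (is_derive_ln_comp (g := fun y => intS_leb S (fun s => p1 s * e y s)) Z0 dZ).
apply: (is_derive_eq dJ).
have cFd : {within S, continuous (fun s => p1 s * e x s * dV T x s)}.
  by apply: within_continuousM => //; exact: dV_slice.
rewrite intSZ// /GRing.scale/= mulrA mulKf// mulrC -intSZ//.
by apply: intS_eq => s _; rewrite /rho /= /p1star /Vsoft subn1 mulrA [_^-1 * _]mulrC.
Qed.

Lemma policy_gradient (x : R) : is_derive x 1 (fun y => Jbeta S beta T p1 p r (mu y))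
  (\sum_(1 <= t < T.+1) intS_leb S (fun s => rhostar S beta T p1 p r (mu x) t s *
     \sum_j dmu x s 0 j * gradc (Qsoft S beta T p r (mu x) t s) (mu x s) j 0)).
Proof.
apply: (is_derive_eq (J_is_derive x)).
(* The telescoping quantity: [u 0] is the derivative of the objective, and [u T] vanishes because
   [dV 0] does. *)
pose u k := intS_leb S (fun s => rho k x s * dV (T - k) x s).
have u0 : intS_leb S (fun s => rho 0 x s * dV T x s) = u 0%N by rewrite /u subn0.
have uT : u T = 0.
  rewrite /u subnn -(mul0r (intS_leb S (fun=> 1 : R))) -intSZ//.
    by apply: intS_eq => s _; rewrite /= mulr0 mul0r.
  exact: within_continuous_cst.
have tel : u 0%N = \sum_(0 <= k < T) - (u k.+1 - u k).
  by rewrite sumrN telescope_sumr// uT sub0r opprK.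
rewrite big_add1 /= u0 tel; apply: eq_big_nat => k /andP[_ kT].
rewrite opprB [u k]rho_step// addrK.
apply: intS_eq => s Ss; congr (_ * _); apply: eq_bigr => j _.
by rewrite /Qsoft /Vsoft subSS -gradQ//; exact: V_slice.
Qed.

End Family.
End PolicyGradient.

(** * From one-parameter families to the full gradient *)

Unset Implicit Arguments.
Set Strict Implicit.

Theorem theorem2 (R : realType) (d m n T : nat) (S : set 'rV[R]_d) (beta : R)
    (p1 : 'rV[R]_d -> R) (p : 'rV[R]_d -> 'rV[R]_m -> 'rV[R]_d -> R)
    (r : 'rV[R]_d -> 'rV[R]_m -> R) (mu : 'rV[R]_n -> 'rV[R]_d -> 'rV[R]_m) :
  beta != 0 ->
  (* p_1 and p(.|s,a) are probability densities on S *)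
  (forall s, S s -> 0 <= p1 s) ->
  intS_leb S p1 = 1 ->
  (forall s a s', S s -> S s' -> 0 <= p s a s') ->
  (forall s a, S s -> intS_leb S (p s a) = 1) ->
  (* (D1) *)
  {within S `*` [set: 'rV[R]_m] `*` S, continuous (fun x => p x.1.1 x.1.2 x.2)} ->
  (forall s a s' (j : 'I_m), S s -> S s' -> derivable (fun a0 => p s a0 s') a (evec R j)) ->
  {within S `*` [set: 'rV[R]_m] `*` S,
     continuous (fun x => gradc (fun a0 => p x.1.1 a0 x.2) x.1.2)} ->
  {within [set: 'rV[R]_n] `*` S, continuous (fun x => mu x.1 x.2)} ->
  (forall th s (i : 'I_n), S s -> derivable (mu ^~ s) th (evec R i)) ->
  {within [set: 'rV[R]_n] `*` S, continuous (fun x => jacT (mu ^~ x.2) x.1)} ->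
  {within S `*` [set: 'rV[R]_m], continuous (fun x => r x.1 x.2)} ->
  (forall s a (j : 'I_m), S s -> derivable (r s) a (evec R j)) ->
  {within S `*` [set: 'rV[R]_m], continuous (fun x => gradc (r x.1) x.2)} ->
  {within S, continuous p1} ->
  (* (D2) *)
  (exists b L : R,
     [/\ (forall s, S s -> p1 s < b),
         (forall s a s', S s -> S s' -> p s a s' < b),
         (forall s a, S s -> `|r s a| < b),
         (forall s a s', S s -> S s' -> `|gradc (fun a0 => p s a0 s') a| < L) &
         (forall s a, S s -> `|gradc (r s) a| < L)]) ->
  (* (D3) *)
  compact S ->
  forall th : 'rV[R]_n,
    (forall i : 'I_n,
       derivable (fun th' => Jbeta S beta T p1 p r (mu th')) th (evec R i)) /\
    gradc (fun th' => Jbeta S beta T p1 p r (mu th')) th =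
    \sum_(1 <= t < T.+1)
      \col_i intS_leb S (fun s =>
        rhostar S beta T p1 p r (mu th) t s *
        (jacT (mu ^~ s) th *m gradc (Qsoft S beta T p r (mu th) t s) (mu th s)) i 0).
Proof.
move=> beta0 p1_ge0 p1_int p_ge0 p_int p_cont p_der gradp_cont mu_cont mu_der jac_cont.
move=> r_cont r_der gradr_cont p1_cont _ cS th.
pose line (i : 'I_n) (x : R) := x *: evec R i + th.
(* The Jacobian is taken at every point of the line, not just at [th], because the family lemmas
   require the derivative at all parameters. *)
pose dmu i x s : 'rV[R]_m := row i (jacT (mu ^~ s) (line i x)).
have cline i : {within [set: R] `*` S, continuous (fun z => (line i z.1, z.2))}.
  apply: within_continuous_pair; last first.
    by apply/(within_continuous_snd (f := id))/within_continuous_id.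
  apply/(within_continuous_fst (f := line i))/continuous_subspaceT => x.
  by apply: cvgD; [apply: cvgZr_tmp; exact: cvg_id|exact: cvg_cst].
have lineS (i : 'I_n) z : ([set: R] `*` S) z -> ([set: 'rV[R]_n] `*` S) (line i z.1, z.2).
  by case.
have muc i := within_continuous_comp (cline i) (lineS i) mu_cont.
have dmuc i j : {within [set: R] `*` S, continuous (fun z => dmu i z.1 z.2 0 j)}.
  have cj := within_continuous_comp (cline i) (lineS i) jac_cont.
  rewrite (_ : (fun z => _) = (fun z => jacT (mu ^~ z.2) (line i z.1) i j)); last first.
    by apply/funext => z; rewrite mxE.
  apply: (within_continuous_post (g := fun M : 'M[R]_(n, m) => M i j) cj) => z _.
  exact: coord_continuous.
have mud i (x : R) s : S s -> is_derive x 1 (fun y => mu (line i y) s) (dmu i x s).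
  move=> Ss; apply: (is_derive_eq (is_derive_line (mu_der _ _ _ Ss))).
  by apply/rowP => j; rewrite !mxE.
have J' i : is_derive th (evec R i) (fun th' => Jbeta S beta T p1 p r (mu th'))
    (\sum_(1 <= t < T.+1) intS_leb S (fun s => rhostar S beta T p1 p r (mu th) t s *
      (jacT (mu ^~ s) th *m gradc (Qsoft S beta T p r (mu th) t s) (mu th s)) i 0)).
  apply: is_derive_of_line.
  have := policy_gradient T beta0 cS p1_ge0 p1_int p1_cont p_ge0 p_int p_cont p_der
    gradp_cont r_cont r_der gradr_cont (muc i) (dmuc i) (mud i) 0.
  rewrite (_ : mu (line i 0) = mu th); last by rewrite /line scale0r add0r.
  move=> dJ; apply: (is_derive_eq dJ); apply: eq_bigr => t _; apply: intS_eq => s _.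
  congr (_ * _); rewrite mxE; apply: eq_bigr => j _.
  by rewrite /dmu /line scale0r add0r mxE.
split=> [i|]; first by case: (J' i).
apply/colP => i; rewrite mxE summxE; have [_ ->] := J' i.
by apply: eq_bigr => t _; rewrite mxE.
Qed.
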